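(* Let $G$ be a countable group. Then $\mathrm{LO}(G)$, regarded as the subset $\{c_<\}$ of $\mathrm{CO}(G)$ consisting of the circular orders arising from left-invariant linear orders $<$ on $G$, is closed in $\mathrm{CO}(G)$.
   Context: A left-invariant circular order on a group $G$ is a map $\phi:G^3\to\{-1,0,1\}$ such that: (DV) $\phi(x,y,z)=0$ if and only if at least two of $x,y,z$ are equal; (C) $\phi(g_1,g_2,g_3)-\phi(g_0,g_2,g_3)+\phi(g_0,g_1,g_3)-\phi(g_0,g_1,g_2)=0$ for all $g_0,\dots,g_3\in G$; (H) $\phi(gg_0,gg_1,gg_2)=\phi(g_0,g_1,g_2)$ for all $g,g_0,g_1,g_2\in G$. The set $\mathrm{CO}(G)$ of all left-invariant circular orders on $G$ has the subspace topology from $\{-1,0,1\}^{G^3}$ (product topology, $\{-1,0,1\}$ discrete). A left-invariant linear order on $G$ is a total order $<$ with $a<b\Rightarrow ga<gb$. It gives the circular order $c_<$: $c_<(x,y,z)=+1$ if $x<y<z$, $y<z<x$ or $z<x<y$; $c_<(x,y,z)=-1$ if $x<z<y$, $y<x<z$ or $z<y<x$; and $c_<(x,y,z)=0$ otherwise. *)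

(* Defs.v *)
From HB Require Import structures.
From mathcomp Require Import all_boot all_order all_algebra.
From mathcomp Require Import all_classical all_reals all_analysis.

Set Implicit Arguments.
Unset Strict Implicit.
Unset Printing Implicit Defensive.

Import Order.TTheory GRing.Theory Num.Theory.

Local Open Scope classical_set_scope.
Local Open Scope ring_scope.

Local Notation sign_set := {s : int | s \in [:: -1; 0; 1]}.

Definition sign : discreteTopologicalType := discrete_topology sign_set.

Definition sign_val (s : sign) : int := sval (s : sign_set).

Definition sign_pos : sign := exist _ (1 : int) isT : sign_set.
Definition sign_zero : sign := exist _ (0 : int) isT : sign_set.
Definition sign_neg : sign := exist _ (-1 : int) isT : sign_set.

Section CircularOrders.
Variable G : groupType.

(* {ptws _ -> _} carries the product topology. *)
Definition sign_maps : topologicalType := {ptws (G * G * G) -> sign}.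

Definition circ_order (phi : sign_maps) : Prop :=
  let c (x y z : G) : int := sign_val (phi (x, y, z)) in
  [/\ forall x y z : G, c x y z = 0 <-> [\/ x = y, y = z | x = z],
      forall g0 g1 g2 g3 : G,
        c g1 g2 g3 - c g0 g2 g3 + c g0 g1 g3 - c g0 g1 g2 = 0
    & forall g g0 g1 g2 : G,
        c (g * g0)%g (g * g1)%g (g * g2)%g = c g0 g1 g2].

(* As a type, CO is its set_type, whose canonical topology is the subspace
   topology inherited from sign_maps. *)
Definition CO : set sign_maps := [set phi | circ_order phi].

(* A linear order is given by its strict relation. *)
Definition left_linear_order (lt : rel G) : Prop :=
  [/\ irreflexive lt,
      transitive lt,
      forall a b : G, a <> b -> lt a b \/ lt b a
    & forall g a b : G, lt a b -> lt (g * a)%g (g * b)%g].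

Definition circ_of (lt : rel G) : sign_maps :=
  fun p : G * G * G =>
  let: (x, y, z) := p in
  if [|| lt x y && lt y z, lt y z && lt z x | lt z x && lt x y]
  then sign_pos
  else if [|| lt x z && lt z y, lt y x && lt x z | lt z y && lt y x]
  then sign_neg
  else sign_zero.

Definition LO : set CO :=
  [set phi : CO | exists2 lt : rel G,
     left_linear_order lt & set_val phi = circ_of lt].

End CircularOrders.

Arguments CO G : clear implicits.
Arguments LO G : clear implicits.

(* Main.v *)
(* A point phi of the closure of LO is the limit of an ultrafilter F containing
   LO.  Attach to each psi in LO a linear order inducing it: the F-ultralimit of
   these orders is a left-invariant linear order, and it induces phi because the
   value of a circular order at a triple depends on finitely many comparisons. *)
Require Import Defs.
From mathcomp Require Import all_boot all_order all_algebra.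
From mathcomp Require Import all_classical all_reals all_analysis.

Local Open Scope classical_set_scope.

(** Either the set where [b] holds or its complement belongs to [F], so [b] is constant on a member
    of [F]; that constant is its ultralimit. *)
Lemma near_ultra_bool {T : Type} {F : set_system T} (UF : UltraFilter F)
    (b : T -> bool) :
  \forall t \near F, b t = `[< \forall s \near F, b s >].
Proof.
have PF : ProperFilter F := @ultra_proper _ _ UF.
case: asboolP => [bF|]; first exact: bF.
have [//|nbF _] := in_ultra_setVsetC [set t | b t] UF.
by apply: filterS nbF => t /negP/negbTE.
Qed.

(** Evaluation at [p] is continuous on [CO G] and [sign] is discrete, so its fibres are open. *)
Lemma near_CO_eval {G : groupType} (phi : CO G) (p : G * G * G) :
  \forall psi \near phi,
    (set_val psi : sign_maps G) p = (set_val phi : sign_maps G) p.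
Proof.
have evalC : continuous (fun psi : CO G => (set_val psi : sign_maps G) p).
  move=> psi; apply: (@continuous_comp _ _ _
    (set_val : CO G -> sign_maps G) (fun f : sign_maps G => f p)).
    exact: initial_continuous.
  exact: proj_continuous.
exact: (evalC phi [set s | s = _] (discrete_set1 _)).
Qed.

(** Each axiom involves at most three comparisons, so some single [lt t] satisfies the axioms and
    agrees with the limit on all of them. *)
Lemma left_linear_order_ultra_lim {G : groupType} {T : Type}
    {F : set_system T} (UF : UltraFilter F) (lt : T -> rel G) :
  (\forall t \near F, left_linear_order (lt t)) ->
  left_linear_order (fun x y => `[< \forall t \near F, lt t x y >]).
Proof.
have PF : ProperFilter F := @ultra_proper _ _ UF.
move=> ltF; have limE x y := near_ultra_bool UF (fun t => lt t x y).
split=> [x|y x z xy yz|x y xy|g x y xy].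
- by have [t [[irr _ _ _] <-]] := filter_ex (filterI ltF (limE x x)).
- have [t [[[[_ tr _ _] xyt] yzt] <-]] := filter_ex
    (filterI (filterI (filterI ltF (limE x y)) (limE y z)) (limE x z)).
  by apply: (tr y); rewrite ?xyt ?yzt.
- have [t [[[_ _ tot _] <-] <-]] := filter_ex
    (filterI (filterI ltF (limE x y)) (limE y x)).
  exact: tot.
- have [t [[[_ _ _ inv] xyt] <-]] := filter_ex
    (filterI (filterI ltF (limE x y)) (limE (g * x)%g (g * y)%g)).
  by apply: inv; rewrite xyt.
Qed.

(** Only six comparisons among the entries of [p] matter, and a finite intersection of members of
    [F] is a member. *)
Lemma near_circ_of_ultra_lim {G : groupType} {T : Type}
    {F : set_system T} (UF : UltraFilter F) (lt : T -> rel G) (p : G * G * G) :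
  \forall t \near F,
    circ_of (lt t) p = circ_of (fun x y => `[< \forall s \near F, lt s x y >]) p.
Proof.
have PF : ProperFilter F := @ultra_proper _ _ UF.
have limE x y := near_ultra_bool UF (fun t => lt t x y).
case: p => [[x y] z]; rewrite /circ_of.
near=> t.
have -> : lt t x y = `[< \forall s \near F, lt s x y >] by near: t; exact: limE.
have -> : lt t y z = `[< \forall s \near F, lt s y z >] by near: t; exact: limE.
have -> : lt t z x = `[< \forall s \near F, lt s z x >] by near: t; exact: limE.
have -> : lt t x z = `[< \forall s \near F, lt s x z >] by near: t; exact: limE.
have -> : lt t z y = `[< \forall s \near F, lt s z y >] by near: t; exact: limE.
have -> : lt t y x = `[< \forall s \near F, lt s y x >] by near: t; exact: limE.
by [].
Unshelve. all: by end_near. Qed.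

Theorem corollary2p17 (G : groupType) (hG : countable [set: G]) :
  closed (LO G).
Proof.
have /choice[lt ltP] : forall psi : CO G, exists lt : rel G,
    LO G psi -> left_linear_order lt /\ set_val psi = circ_of lt.
  move=> psi; have [[lt ltl psiE]|nLO] := pselect (LO G psi); first by exists lt.
  (* The empty relation is a dummy value off [LO G]; the ultrafilter chosen below contains [LO G],
     so the limit does not see it. *)
  by exists (fun _ _ => false).
(* As [phi] is in the closure, the trace of its neighbourhoods on [LO G] is a proper filter, which
   [F] refines. *)
move=> phi /within_nbhs_proper/ultraFilterLemma[F [UF nbhsF]].
have PF : ProperFilter F := @ultra_proper _ _ UF.
have LOF : F (LO G) by apply: nbhsF; exact: withinT.
have phiF : F --> phi by move=> A Aphi; apply: nbhsF; apply: (@cvg_within _ (nbhs phi)).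
exists (fun x y => `[< \forall psi \near F, lt psi x y >]).
  by apply: left_linear_order_ultra_lim; apply: filterS LOF => psi /ltP[].
apply/funext => p.
(* One [psi] in [LO G] agrees with [phi] at [p], while [lt psi] and the limit order induce the same
   value there; [psi] may depend on [p]. *)
have [psi [[/ltP[_ psiE] <-] <-]] := filter_ex (filterI
  (filterI LOF (phiF _ (near_CO_eval phi p))) (near_circ_of_ultra_lim UF lt p)).
by rewrite psiE.
Qed.
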